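(* Let $n \ge 1$ be an integer and let $k, m$ be integers with $0 \le k \le n$ and $0 \le m \le n$. Let $C(n,k,m)$ be the coefficients of the Pauli expansion of the number projection operator $\hat P(n,k)$, as defined in the context. Then: (i) $$C(n,k,m) = \sum_{l=0}^{m} (-1)^l \binom{n-m}{k-l}\binom{m}{l}.$$ (ii) In particular, for $m = 0$, $$C(n,k,0) = \binom{n}{k}.$$ (iii) If $m \ne n$, then $$C(n,k,m) = C(n-1,k,m) + C(n-1,k-1,m).$$ (iv) If $m \ne 0$, then $$C(n,k,m) = C(n-1,k,m-1) - C(n-1,k-1,m-1).$$
   Context: The $n$-qubit space is $(\mathbb{C}^2)^{\otimes n}$ with computational basis states $|b\rangle$, $b \in \{0,1\}^n$. The Hamming weight of $b$ is the number of its bits equal to $1$. For an integer $k$, the number projection operator $\hat P(n,k)$ is the linear operator on $(\mathbb{C}^2)^{\otimes n}$ that maps each computational basis state of Hamming weight $k$ to itself and every other computational basis state to $0$. Thus $\hat P(n,k) = 0$ if $k<0$ or $k>n$. For $n=0$ the space is $\mathbb{C}$ and $\hat P(0,0)=1$. $Z$ denotes the Pauli operator with $Z|0\rangle = |0\rangle$ and $Z|1\rangle = -|1\rangle$. The notation $Z_{i_1}\otimes\cdots\otimes Z_{i_m}$ stands for the $n$-qubit operator acting as $Z$ on qubits $i_1,\dots,i_m$ and as the identity on all other qubits (for $m=0$ it is the identity operator). Since $\hat P(n,k)$ is diagonal in the computational basis and invariant under permutations of the qubits, there are unique numbers $C(n,k,m)$, $0\le m\le n$, such that $$\hat P(n,k)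 = \frac{1}{2^n}\sum_{m=0}^{n} C(n,k,m) \sum_{\{i_1,\dots,i_m\}\in I_m} Z_{i_1}\otimes\cdots\otimes Z_{i_m},$$ where $I_m$ is the set of the $\binom{n}{m}$ $m$-element subsets of $\{0,\dots,n-1\}$. These numbers define $C(n,k,m)$; in particular $C(n,k,m)=0$ for $k<0$ or $k>n$, and $C(0,0,0)=1$. Binomial coefficients $\binom{a}{b}$ with $a \ge 0$ are taken to be $0$ when $b<0$ or $b>a$. *)

(* Defs.v *)
From HB Require Import structures.
From mathcomp Require Import all_boot all_order all_fingroup all_algebra.
From mathcomp Require Export complex reals.

Set Implicit Arguments.
Unset Strict Implicit.
Unset Printing Implicit Defensive.

Import Order.TTheory GRing.Theory Num.Theory.
Local Open Scope ring_scope.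

Definition bits (n : nat) : finType := {ffun 'I_n -> 'I_2}.

Definition hamming (n : nat) (b : bits n) : nat := #|[set i | b i == 1]|.

(* The n-qubit space: a state is given by its amplitudes in the computational
   basis. *)
Definition qubits (C : numFieldType) (n : nat) : vectType C :=
  {ffun bits n -> C^o}.

Definition ket (C : numFieldType) (n : nat) (b : bits n) : qubits C n :=
  [ffun b' => (b' == b)%:R].

(* The linear operator with prescribed images of the computational basis
   states; see [opK] below. *)
Definition op_fun (C : numFieldType) (n : nat) (f : bits n -> qubits C n)
    (psi : qubits C n) : qubits C n :=
  \sum_b (psi b : C) *: f b.

Lemma op_fun_linear (C : numFieldType) (n : nat) (f : bits n -> qubits C n) :
  linear (op_fun f).
Proof.
move=> a u v; rewrite /op_fun scaler_sumr -big_split /=.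
by apply: eq_bigr => b _; rewrite !ffunE scalerDl scalerA.
Qed.

HB.instance Definition _ (C : numFieldType) (n : nat)
    (f : bits n -> qubits C n) :=
  GRing.isLinear.Build C (qubits C n) (qubits C n) *:%R (op_fun f)
    (op_fun_linear f).

Definition op (C : numFieldType) (n : nat) (f : bits n -> qubits C n) :
    'End(qubits C n) :=
  linfun (op_fun f).

Definition number_proj (C : numFieldType) (n : nat) (k : int) :
    'End(qubits C n) :=
  op (fun b => if (hamming b)%:Z == k then ket C b else 0).

Definition pauliZ (C : numFieldType) : 'M[C]_2 := diag_mx (\row_i (-1) ^+ i).

(* A_0 (x) ... (x) A_(n-1), where A i acts on qubit i by |y> |-> \sum_x
   A i x y |x>. *)
Definition tensor_op (C : numFieldType) (n : nat) (A : 'I_n -> 'M[C]_2) :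
    'End(qubits C n) :=
  op (fun b => \sum_(b' : bits n) (\prod_i A i (b' i) (b i)) *: ket C b').

Definition Z_string (C : numFieldType) (n : nat) (I : {set 'I_n}) :
    'End(qubits C n) :=
  tensor_op (fun i => if i \in I then pauliZ C else 1%:M).

Definition pauli_expansion (C : numFieldType) (n : nat) (k : int)
    (c : n.+1.-tuple C) : bool :=
  number_proj C n k ==
    (2 ^+ n)^-1 *: \sum_(m < n.+1) tnth c m *:
       \sum_(I : {set 'I_n} | #|I| == m) Z_string C I.

Lemma opK (C : numFieldType) (n : nat) (f : bits n -> qubits C n) b :
  op f (ket C b) = f b.
Proof.
rewrite lfunE /= /op_fun (bigD1 b) //= big1 => [|b' nb].
  by rewrite ffunE eqxx scale1r addr0.
by rewrite ffunE (negPf nb) scale0r.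
Qed.

Lemma ket_eq (C : numFieldType) (n : nat) (f g : 'End(qubits C n)) :
  (forall b, f (ket C b) = g (ket C b)) -> f = g.
Proof.
move=> fg; apply/lfunP => u.
have -> : u = \sum_b (u b : C) *: ket C b.
  apply/ffunP => b; rewrite sum_ffunE (bigD1 b) //= big1 => [|b' nb].
    by rewrite !ffunE eqxx addr0 [_ *: _]mulr1.
  by rewrite !ffunE eq_sym (negPf nb) [_ *: _]mulr0.
by rewrite !linear_sum; apply: eq_bigr => b _; rewrite !linearZ /= fg.
Qed.

Lemma ket_neq0 (C : numFieldType) (n : nat) (b : bits n) : ket C b != 0.
Proof.
apply/eqP => /ffunP /(_ b); rewrite !ffunE eqxx => /eqP.
by rewrite oner_eq0.
Qed.

Definition parity_sign (C : numFieldType) (n : nat) (I : {set 'I_n})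
    (b : bits n) : C :=
  \prod_i (if i \in I then (-1) ^+ (b i) else 1).

Lemma Z_stringK (C : numFieldType) (n : nat) (I : {set 'I_n}) (b : bits n) :
  Z_string C I (ket C b) = parity_sign C I b *: ket C b.
Proof.
rewrite opK (bigD1 b) //= [X in _ + X]big1 => [|b' nb].
  rewrite addr0; congr (_ *: _); apply: eq_bigr => i _.
  by case: ifP => _; rewrite !mxE eqxx ?mulr1n.
have [i nbi] : exists i, b' i != b i.
  apply/existsP; apply: contraR nb; rewrite negb_exists => /forallP h.
  by apply/eqP/ffunP => i; apply/eqP; have := h i; rewrite negbK.
rewrite (bigD1 i) //=.
by case: ifP => _; rewrite !mxE (negPf nbi) ?mulr0n mul0r scale0r.
Qed.

Lemma pauli_expansionP (C : numFieldType) (n : nat) (k : int)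
    (c : n.+1.-tuple C) :
  reflect (forall b : bits n, ((hamming b)%:Z == k)%:R =
      (2 ^+ n)^-1 * \sum_(I : {set 'I_n}) c`_#|I| * parity_sign C I b)
    (pauli_expansion k c).
Proof.
have rhsE b : ((2 ^+ n)^-1 *: \sum_(m < n.+1) tnth c m *:
       \sum_(I : {set 'I_n} | #|I| == m) Z_string C I) (ket C b) =
    ((2 ^+ n)^-1 * \sum_(I : {set 'I_n}) c`_#|I| * parity_sign C I b)
      *: ket C b.
  rewrite scale_lfunE -scalerA; congr (_ *: _).
  rewrite sum_lfunE scaler_suml.
  have cardI (I : {set 'I_n}) : (#|I| < n.+1)%N.
    by rewrite ltnS (leq_trans (max_card _)) ?card_ord.
  rewrite (partition_big (fun I : {set 'I_n} => Ordinal (cardI I)) predT) //=.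
  apply: eq_bigr => m _; rewrite scale_lfunE sum_lfunE scaler_sumr.
  apply: eq_big => // I /eqP Im.
  by rewrite Z_stringK scalerA (tnth_nth 0) -Im.
have lhsE b : number_proj C n k (ket C b) =
    ((hamming b)%:Z == k)%:R *: ket C b.
  by rewrite opK; case: eqP; rewrite ?scale1r ?scale0r.
apply: (iffP eqP) => [PE b | h]; last by apply: ket_eq => b; rewrite rhsE lhsE h.
have := rhsE b; rewrite -PE lhsE => /eqP.
rewrite -subr_eq0 -scalerBl scaler_eq0 (negPf (ket_neq0 C b)) orbF subr_eq0.
by move/eqP.
Qed.

Lemma parity_sign_orth_set (C : numFieldType) (n : nat) (b b' : bits n) :
  \sum_(I : {set 'I_n}) parity_sign C I b * parity_sign C I b' =
  (b == b')%:R * 2 ^+ n.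
Proof.
transitivity (\prod_(i < n) ((-1) ^+ (b i + b' i)%N + 1) : C).
  rewrite bigA_distr; apply: eq_bigr => I _; rewrite -big_split /=.
  by apply: eq_bigr => i _; case: ifP; rewrite ?mulr1 ?exprD.
have [-> | nb] := eqVneq b b'.
  rewrite mul1r (eq_bigr (fun=> 2)) => [|i _].
    by rewrite prodr_const card_ord.
  by rewrite addnn -mul2n exprM sqrrN expr1n expr1n.
have [i nbi] : exists i, b i != b' i.
  apply/existsP; apply: contraR nb; rewrite negb_exists => /forallP h.
  by apply/eqP/ffunP => i; apply/eqP; have := h i; rewrite negbK.
rewrite mul0r (bigD1 i) //=.
suff -> : (b i + b' i)%N = 1%N by rewrite expr1 addNr mul0r.
by move: nbi; case: (b i) (b' i) => [[|[|?]] ?] [[|[|?]] ?].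
Qed.

Lemma parity_sign_orth_bits (C : numFieldType) (n : nat) (I J : {set 'I_n}) :
  \sum_(b : bits n) parity_sign C I b * parity_sign C J b =
  (I == J)%:R * 2 ^+ n.
Proof.
transitivity (\prod_(i < n) \sum_(x < 2)
   ((if i \in I then (-1) ^+ x else 1) * (if i \in J then (-1) ^+ x else 1))
   : C).
  by rewrite bigA_distr_bigA; apply: eq_bigr => b _; rewrite -big_split.
have [-> | nIJ] := eqVneq I J.
  rewrite mul1r (eq_bigr (fun=> 2)) => [|i _].
    by rewrite prodr_const card_ord.
  rewrite !big_ord_recl big_ord0 /= addr0.
  by case: ifP => _; rewrite ?expr0 ?expr1 ?mulrNN ?mulr1.
have [i nIi] : exists i, (i \in I) != (i \in J).
  apply/existsP; apply: contraR nIJ; rewrite negb_exists => /forallP h.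
  by apply/eqP/setP => i; apply/eqP; have := h i; rewrite negbK.
rewrite mul0r (bigD1 i) //= !big_ord_recl big_ord0 /= addr0.
move: nIi; case: (i \in I); case: (i \in J) => // _;
  by rewrite !expr0 expr1 !mulr1 ?mul1r subrr mul0r.
Qed.

(* Sets of equal size are exchanged by a permutation of the qubits. *)
Lemma card_eq_perm (n : nat) (I J : {set 'I_n}) :
  #|I| = #|J| -> exists s : 'S_n, forall i, (i \in I) = (s i \in J).
Proof.
move=> eqIJ.
pose t (A : {set 'I_n}) := [tuple i \in A | i < n].
have cnt A : count_mem true (t A) = #|A|.
  rewrite cardE [t A]/= count_map /enum_mem size_filter count_filter.
  by apply: eq_count => i /=; rewrite !inE andbT; case: (i \in A).
have cnt0 A : (count_mem false (t A) + #|A| = n)%N.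
  rewrite -(cnt A) -[RHS](size_tuple (t A)) -(count_predC (pred1 true)) addnC.
  by congr (_ + _)%N; apply: eq_count => -[].
have : perm_eq (t I) (t J).
  apply/allP => -[] _ /=; apply/eqP; first by rewrite !cnt.
  by apply/eqP; rewrite -(eqn_add2r #|I|) cnt0 eqIJ cnt0.
case/tuple_permP => s ts; exists s => i.
have {ts}/val_inj ts := ts.
by have := congr1 (fun u => tnth u i) ts; rewrite !tnth_mktuple.
Qed.

Lemma sum_parity_sign_card (C : numFieldType) (n : nat) (k : int)
    (I J : {set 'I_n}) : #|I| = #|J| ->
  \sum_(b : bits n | (hamming b)%:Z == k) parity_sign C I b =
  \sum_(b : bits n | (hamming b)%:Z == k) parity_sign C J b.
Proof.
case/card_eq_perm => s sIJ.
pose h (b : bits n) : bits n := [ffun i => b (s i)].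
have h_bij : bijective h.
  exists (fun b : bits n => [ffun i => b (s^-1%g i)] : bits n) => b;
    by apply/ffunP => i; rewrite !ffunE ?permK ?permKV.
rewrite (reindex h) /=; last exact: onW_bij.
apply: eq_big => [b | b _].
  congr (Posz _ == k); rewrite /hamming.
  rewrite -[RHS](card_preimset _ (@perm_inj _ s)).
  by apply: eq_card => i; rewrite !inE ffunE.
rewrite [RHS](reindex_inj (@perm_inj _ s)).
by apply: eq_bigr => i _; rewrite sIJ ffunE.
Qed.

Lemma pauli_expansion_exists (C : numFieldType) (n : nat) (k : int) :
  exists c : n.+1.-tuple C, pauli_expansion k c.
Proof.
pose S m := [set i : 'I_n | (i < m)%N].
exists [tuple \sum_(b : bits n | (hamming b)%:Z == k) parity_sign C (S m) b
       | m < n.+1].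
apply/pauli_expansionP => b.
have cE (I : {set 'I_n}) :
    [tuple \sum_(b : bits n | (hamming b)%:Z == k) parity_sign C (S m) b
       | m < n.+1]`_#|I| =
    \sum_(b : bits n | (hamming b)%:Z == k) parity_sign C I b.
  have leI : (#|I| <= n)%N by rewrite (leq_trans (max_card _)) ?card_ord.
  have ltI : (#|I| < n.+1)%N by [].
  rewrite -[#|I| in LHS]/(nat_of_ord (Ordinal ltI)) -tnth_nth tnth_mktuple.
  apply: sum_parity_sign_card => /=.
  have winj : injective (widen_ord leI).
    by move=> i j /(congr1 val) /= ij; apply: val_inj.
  rewrite -[RHS]card_ord -(card_imset _ winj).
  apply: eq_card => i; rewrite inE; apply/idP/imsetP => [ltiI | [j _ ->]].
    by exists (Ordinal ltiI) => //; apply: val_inj.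
  exact: (ltn_ord j).
under eq_bigr => I _ do rewrite cE mulr_suml.
rewrite exchange_big /=.
under eq_bigr => b' _ do rewrite parity_sign_orth_set.
rewrite -mulr_suml mulrCA mulVf ?mulr1 ?expf_neq0 ?pnatr_eq0 //.
have [hb | hb] := boolP ((hamming b)%:Z == k).
  rewrite (bigD1 b) //= eqxx big1 ?addr0 // => b' /andP [_ nb].
  by rewrite (negPf nb).
rewrite big1 // => b' hb'.
by have [bb|//] := eqVneq b' b; rewrite -bb hb' in hb.
Qed.

Lemma pauli_expansion_unique (C : numFieldType) (n : nat) (k : int)
    (c c' : n.+1.-tuple C) :
  pauli_expansion k c -> pauli_expansion k c' -> c = c'.
Proof.
have coefE (d : n.+1.-tuple C) (J : {set 'I_n}) : pauli_expansion k d ->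
    d`_#|J| = \sum_(b : bits n) ((hamming b)%:Z == k)%:R * parity_sign C J b.
  move/pauli_expansionP => dE.
  under eq_bigr => b _ do rewrite dE -mulrA mulr_suml.
  rewrite -mulr_sumr exchange_big /=.
  under eq_bigr => I _.
    under eq_bigr => b _ do rewrite -mulrA.
    rewrite -mulr_sumr parity_sign_orth_bits mulrCA mulrA; over.
  rewrite (bigD1 J) //= eqxx mul1r big1 ?addr0 => [|I nIJ].
    by rewrite mulrCA mulVf ?mulr1 ?expf_neq0 ?pnatr_eq0.
  by rewrite (negPf nIJ) !mul0r.
move=> cE c'E; apply: eq_from_tnth => m; rewrite !(tnth_nth 0).
have [J Jm] : exists J : {set 'I_n}, #|J| = m.
  have lem : (m <= n)%N by rewrite -ltnS.
  exists [set widen_ord lem j | j in [set: 'I_m]].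
  rewrite card_imset ?cardsT ?card_ord // => i j /(congr1 val) /= ij.
  exact: val_inj.
by rewrite -Jm !coefE.
Qed.

Definition pauli_coeffs (C : numFieldType) (n : nat) (k : int) :
    n.+1.-tuple C :=
  xchoose (pauli_expansion_exists C n k).

(* C(n,k,m), with value 0 when m > n. *)
Definition pauli_coeff (C : numFieldType) (n : nat) (k : int) (m : nat) : C :=
  (pauli_coeffs C n k)`_m.

(* Binomial coefficient with an integer lower index, 0 if it is negative. *)
Definition binz (a : nat) (b : int) : nat :=
  if b is Posz j then 'C(a, j) else 0%N.

(* Main.v *)
(* By orthogonality of the characters b |-> (-1)^|I :&: b|, C(n,k,m) is the sum
   of the character of any m-element set I over the bit strings of weight k.
   Its generating function in k factors over the qubits, so C(n,k,m) is the
   coefficient of 'X^k in (1 - 'X)^m (1 + 'X)^(n-m). Formula (i) is the binomial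
   expansion of both powers, and the recurrences (iii) and (iv) come from
   splitting off one factor 1 + 'X or 1 - 'X. *)
Require Import Defs.
From mathcomp Require Import all_boot all_order all_algebra.
From mathcomp Require Import complex reals.

Import GRing.Theory Num.Theory.
Local Open Scope ring_scope.

(** With an integer index and value 0 below zero, multiplication by ['X] is an exact shift of [k],
    with no boundary case. *)
Definition coefz {C : nzRingType} (p : {poly C}) (k : int) : C :=
  if k is Posz j then p`_j else 0.

Lemma coefzD (C : nzRingType) (p q : {poly C}) (k : int) :
  coefz (p + q) k = coefz p k + coefz q k.
Proof. by case: k => j /=; rewrite ?coefD ?addr0. Qed.

Lemma coefzB (C : nzRingType) (p q : {poly C}) (k : int) :
  coefz (p - q) k = coefz p k - coefz q k.
Proof. by case: k => j /=; rewrite ?coefB ?subr0. Qed.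

Lemma coefzZ (C : nzRingType) (a : C) (p : {poly C}) (k : int) :
  coefz (a *: p) k = a * coefz p k.
Proof. by case: k => j /=; rewrite ?coefZ ?mulr0. Qed.

Lemma coefz_sum (C : nzRingType) (I : Type) (r : seq I) (P : pred I)
    (F : I -> {poly C}) (k : int) :
  coefz (\sum_(i <- r | P i) F i) k = \sum_(i <- r | P i) coefz (F i) k.
Proof. by case: k => j /=; [rewrite coef_sum | rewrite big1]. Qed.

Lemma coefzMX (C : nzRingType) (p : {poly C}) (k : int) :
  coefz (p * 'X) k = coefz p (k - 1).
Proof.
(* For [k = 0] the shifted index is -1, so both sides are 0. *)
case: k => [[|j]|j] //; first by rewrite /= coefMX.
by rewrite [j.+1%:Z]intS [1 + _]addrC addrK /= coefMX addn1.
Qed.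

Lemma coefzMXn (C : nzRingType) (p : {poly C}) (l : nat) (k : int) :
  coefz (p * 'X^l) k = coefz p (k - l%:Z).
Proof.
elim: l k => [|l IHl] k; first by rewrite expr0 mulr1 subr0.
by rewrite exprSr mulrA coefzMX IHl intS opprD addrA.
Qed.

Lemma coefz_1DXn (C : comNzRingType) (a : nat) (k : int) :
  coefz ((1 + 'X : {poly C}) ^+ a) k = (binz a k)%:R.
Proof.
case: k => j //=; rewrite exprDn coef_sum.
under eq_bigr => i _ do rewrite expr1n mul1r coefMn coefXn.
have [lt_ja | lt_aj] := ltnP j a.+1.
  rewrite (bigD1 (Ordinal lt_ja)) //= eqxx big1 ?addr0 // => i nij.
  by rewrite -val_eqE eq_sym in nij; rewrite (negPf nij) mul0rn.
rewrite bin_small // big1 // => i _.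
by rewrite gtn_eqF ?mul0rn // (leq_trans (ltn_ord i)).
Qed.

Lemma hamming_sum (n : nat) (b : bits n) : hamming b = (\sum_i b i)%N.
Proof.
rewrite /hamming -sum1_card [LHS]big_mkcond /=; apply: eq_bigr => i _.
by rewrite inE; case: (b i) => -[|[|]].
Qed.

(** The sign and ['X^(hamming b)] are both products over the qubits, so distributivity turns the sum
    over bit strings into a product of two-term sums. *)
Lemma sum_parity_sign_gen (C : numFieldType) (n : nat) (I : {set 'I_n}) :
  \sum_(b : bits n) parity_sign C I b *: 'X^(hamming b) =
  (1 - 'X) ^+ #|I| * (1 + 'X) ^+ (n - #|I|).
Proof.
transitivity (\prod_(i < n) \sum_(x < 2)
    (if i \in I then (-1) ^+ x else 1) *: ('X^x : {poly C})).
  rewrite bigA_distr_bigA; apply: eq_bigr => b _.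
  by rewrite scaler_prod hamming_sum expr_sum.
transitivity (\prod_(i < n) if i \in I then 1 - 'X else 1 + 'X : {poly C}).
  apply: eq_bigr => i _; rewrite !big_ord_recl big_ord0 /= addr0.
  by case: ifP => _; rewrite !expr0 ?expr1 ?scaleN1r !scale1r.
rewrite (bigID (mem I)) /= (eq_bigr (fun=> 1 - 'X)) => [|i ->] //.
rewrite prodr_const; congr (_ * _).
rewrite (eq_bigr (fun=> 1 + 'X)) => [|i /negPf->] //.
rewrite prodr_const; congr (_ ^+ _).
(* The exponent [n - #|I|] is the size of the complement of [I]. *)
rewrite -[X in (X - _)%N]card_ord -(cardC (mem I)) addKn.
by apply: eq_card => i; rewrite !inE.
Qed.

(** Fourier inversion: the indicator of weight [k] is replaced by its Pauli expansion, and
    orthogonality keeps only the term of [I]. *)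
Lemma pauli_coeff_sum (C : numFieldType) (n : nat) (k : int)
    (I : {set 'I_n}) :
  pauli_coeff C n k #|I| =
  \sum_(b : bits n) ((hamming b)%:Z == k)%:R * parity_sign C I b.
Proof.
have /pauli_expansionP cE := xchooseP (pauli_expansion_exists C n k).
under eq_bigr => b _ do rewrite cE -mulrA mulr_suml.
rewrite -mulr_sumr exchange_big /=.
under eq_bigr => J _.
  under eq_bigr => b _ do rewrite -mulrA.
  rewrite -mulr_sumr parity_sign_orth_bits mulrCA mulrA; over.
rewrite (bigD1 I) //= eqxx mul1r big1 ?addr0 => [|J nJI].
  by rewrite mulrCA mulVf ?mulr1 ?expf_neq0 ?pnatr_eq0.
by rewrite (negPf nJI) !mul0r.
Qed.

Lemma pauli_coeff_gen (C : numFieldType) (n : nat) (k : int) (m : nat) :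
  (m <= n)%N ->
  pauli_coeff C n k m =
  coefz ((1 - 'X : {poly C}) ^+ m * (1 + 'X) ^+ (n - m)) k.
Proof.
move=> le_mn.
(* Any set of size [m] serves; the first [m] qubits are taken. *)
have [I <-] : exists I : {set 'I_n}, #|I| = m.
  exists [set widen_ord le_mn j | j in [set: 'I_m]].
  rewrite card_imset ?cardsT ?card_ord // => i j /(congr1 val) /= ij.
  exact: val_inj.
rewrite pauli_coeff_sum -sum_parity_sign_gen coefz_sum.
apply: eq_bigr => b _; rewrite coefzZ mulrC; congr (_ * _).
by case: k => j //=; rewrite coefXn eq_sym.
Qed.

Lemma pauli_coeff_binomial (C : numFieldType) (n : nat) (k : int) (m : nat) :
  (m <= n)%N ->
  pauli_coeff C n k m =
  \sum_(0 <= l < m.+1)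
    (-1) ^+ l * (binz (n - m) (k - l%:Z))%:R * 'C(m, l)%:R.
Proof.
move=> le_mn; rewrite pauli_coeff_gen // exprDn mulr_suml coefz_sum big_mkord.
(* The right-hand side is folded back into one coefficient at [k], the shift by [l] becoming a
   factor ['X^l]; a polynomial identity remains. *)
apply: eq_bigr => l _; rewrite -coefz_1DXn -coefzMXn -coefzZ [RHS]mulrC -coefzZ.
congr (coefz _ _).
rewrite expr1n mul1r [(- 'X) ^+ _]exprNn -[(-1) ^+ l *: _]mul_polyC rmorphXn /= rmorphN1.
by rewrite scaler_nat mulrnAl -mulrA ['X^l * _]mulrC.
Qed.

(** As [m <= n], some qubit carries the identity; its factor [1 + 'X] is split off. *)
Lemma pauli_coeff_rec_id (C : numFieldType) (n : nat) (k : int) (m : nat) :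
  (m <= n)%N ->
  pauli_coeff C n.+1 k m = pauli_coeff C n k m + pauli_coeff C n (k - 1) m.
Proof.
move=> le_mn; rewrite !pauli_coeff_gen ?leqW // subSn // exprSr mulrA.
by rewrite mulrDr mulr1 coefzD coefzMX.
Qed.

(** Here a qubit carrying Z is removed, with its factor [1 - 'X]; the exponent of [1 + 'X] is
    unchanged. *)
Lemma pauli_coeff_rec_Z (C : numFieldType) (n : nat) (k : int) (m : nat) :
  (m <= n)%N ->
  pauli_coeff C n.+1 k m.+1 = pauli_coeff C n k m - pauli_coeff C n (k - 1) m.
Proof.
move=> le_mn; rewrite !pauli_coeff_gen // subSS exprSr mulrAC.
by rewrite mulrBr mulr1 coefzB coefzMX.
Qed.

Theorem theorem2p1 (R : realType) (n : nat) (k : int) (m : nat)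
    (hn : (1 <= n)%N) (hk0 : 0 <= k) (hkn : k <= n%:Z) (hm : (m <= n)%N) :
  [/\ pauli_coeff R[i] n k m =
        \sum_(0 <= l < m.+1)
          (-1) ^+ l * (binz (n - m) (k - l%:Z))%:R * 'C(m, l)%:R,
      pauli_coeff R[i] n k 0 = (binz n k)%:R,
      m <> n ->
        pauli_coeff R[i] n k m =
          pauli_coeff R[i] n.-1 k m + pauli_coeff R[i] n.-1 (k - 1) m
    & m <> 0%N ->
        pauli_coeff R[i] n k m =
          pauli_coeff R[i] n.-1 k m.-1 - pauli_coeff R[i] n.-1 (k - 1) m.-1].
Proof.
case: n hn hkn hm => // n _ _ hm; split.
- exact: pauli_coeff_binomial.
- by rewrite pauli_coeff_gen // expr0 mul1r subn0 coefz_1DXn.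
(* With [n.+1] qubits, [m <= n.+1] and [m <> n.+1] give the bound [m <= n]. *)
- by move/eqP => ne_mn; apply: pauli_coeff_rec_id; rewrite -ltnS ltn_neqAle ne_mn.
- by case: m hm => // m hm _; apply: pauli_coeff_rec_Z.
Qed.
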